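(* Let $n>1$, $x\in K_n$ and $r\in\{0,1,\dots,n\}$. Then $x\in B(f,r)$ if and only if $x e_{[r]}=f$.
   Context: For a natural number $k$, $[k]=\{1,\dots,k\}$, and $[0]=\emptyset$. Kiselman's semigroup $K_n$ is the monoid, with unit element $e$, given by generators $a_1,\dots,a_n$ and relations $a_i^2=a_i$ for all $i\in[n]$, and $a_i a_j a_i = a_j a_i a_j = a_i a_j$ for all $1\le j<i\le n$. For $X\subseteq[n]$, write $X=\{i_1>i_2>\dots>i_k\}$ and set $e_X=a_{i_1}a_{i_2}\cdots a_{i_k}$, with $e_\emptyset=e$; $f=e_{[n]}$ is the zero element of $K_n$. For $X\subseteq[n]$, the deletion endomorphism $\overline{\partial}_X:K_n\to K_n$ is the unique monoid endomorphism with $\overline{\partial}_X(a_i)=a_i$ if $i\notin X$ and $\overline{\partial}_X(a_i)=e$ if $i\in X$. The ultrametric $d$ on $K_n$ is $d(x,y)=\min\{i\in\{0,1,\dots,n\}\mid \overline{\partial}_{[i]}(x)=\overline{\partial}_{[i]}(y)\}$, and $B(a,r)=\{x\in K_n\mid d(a,x)\le r\}$. *)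

(* Defs.v *)
From HB Require Import structures.
From mathcomp Require Import all_boot.
From mathcomp.classical Require Import boolp.

Set Implicit Arguments.
Unset Strict Implicit.
Unset Printing Implicit Defensive.

Local Open Scope group_scope.
Local Open Scope quotient_scope.

(* Generators are indexed from 0: i : 'I_n stands for a_(i+1). *)

Inductive kis_cong (n : nat) : seq 'I_n -> seq 'I_n -> Prop :=
| kis_refl u : kis_cong u u
| kis_sym u v : kis_cong u v -> kis_cong v u
| kis_trans u v w : kis_cong u v -> kis_cong v w -> kis_cong u w
| kis_cat u u' v v' :
    kis_cong u u' -> kis_cong v v' -> kis_cong (u ++ v) (u' ++ v')
| kis_idem i : kis_cong [:: i; i] [:: i]
| kis_aba (i j : 'I_n) : (j < i)%N -> kis_cong [:: i; j; i] [:: i; j]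
| kis_bab (i j : 'I_n) : (j < i)%N -> kis_cong [:: j; i; j] [:: i; j].

Definition kis_eqb (n : nat) : rel (seq 'I_n) := fun u v => `[< kis_cong u v >].

Lemma kis_eqb_refl n : reflexive (@kis_eqb n).
Proof. by move=> u; apply/asboolP/kis_refl. Qed.

Lemma kis_eqb_sym n : symmetric (@kis_eqb n).
Proof. by move=> u v; apply/asboolP/asboolP => /kis_sym. Qed.

Lemma kis_eqb_trans n : transitive (@kis_eqb n).
Proof. by move=> v u w /asboolP uv /asboolP vw; apply/asboolP/(kis_trans uv). Qed.

Canonical kis_equiv n :=
  EquivRel (@kis_eqb n) (@kis_eqb_refl n) (@kis_eqb_sym n) (@kis_eqb_trans n).

Definition kiselman (n : nat) := {eq_quot (@kis_eqb n)}.
HB.instance Definition _ n := Choice.on (kiselman n).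
HB.instance Definition _ n := EqQuotient.on (kiselman n).

Lemma kis_piP n (u v : seq 'I_n) :
  \pi_(kiselman n) u = \pi_(kiselman n) v <-> kis_cong u v.
Proof.
by split=> [/eqquotP/asboolP | uv]; last by apply/eqquotP/asboolP.
Qed.

Lemma kis_repr n (u : seq 'I_n) : kis_cong (repr (\pi_(kiselman n) u)) u.
Proof. by apply/kis_piP; rewrite reprK. Qed.

Lemma kis_ind n (P : kiselman n -> Prop) :
  (forall u : seq 'I_n, P (\pi_(kiselman n) u)) -> forall x, P x.
Proof. by move=> Pu x; rewrite -[x]reprK. Qed.

Definition kis_mul n (x y : kiselman n) : kiselman n :=
  \pi_(kiselman n) (repr x ++ repr y).
Definition kis_one n : kiselman n := \pi_(kiselman n) [::].

Lemma kis_mul_pi n (u v : seq 'I_n) :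
  kis_mul (\pi_(kiselman n) u) (\pi_(kiselman n) v) = \pi_(kiselman n) (u ++ v).
Proof. by apply/kis_piP/kis_cat; apply: kis_repr. Qed.

Lemma kis_mulA n : associative (@kis_mul n).
Proof.
move=> x y z; elim/kis_ind: x => u; elim/kis_ind: y => v; elim/kis_ind: z => w.
by rewrite !kis_mul_pi catA.
Qed.

Lemma kis_mul1 n : left_id (kis_one n) (@kis_mul n).
Proof. by move=> x; elim/kis_ind: x => u; rewrite kis_mul_pi. Qed.

Lemma kis_mulr1 n : right_id (kis_one n) (@kis_mul n).
Proof. by move=> x; elim/kis_ind: x => u; rewrite kis_mul_pi cats0. Qed.

HB.instance Definition _ n :=
  isMonoid.Build (kiselman n) (@kis_mulA n) (@kis_mul1 n) (@kis_mulr1 n).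

Lemma kis_mulgE n (u v : seq 'I_n) :
  \pi_(kiselman n) u * \pi_(kiselman n) v = \pi_(kiselman n) (u ++ v).
Proof. exact: kis_mul_pi. Qed.

Definition kgen n (i : 'I_n) : kiselman n := \pi_(kiselman n) [:: i].

Lemma kis_pi_prod n (u : seq 'I_n) :
  \pi_(kiselman n) u = \prod_(i <- u) kgen i.
Proof.
elim: u => [|i u IHu]; first by rewrite big_nil.
by rewrite big_cons -IHu -[in LHS]cat1s -kis_mulgE.
Qed.

(* The extension to kiselman n of a map on generators; it is a morphism as soon
   as the map satisfies the defining relations. *)
Definition kis_lift n (M : monoidType) (g : 'I_n -> M) (x : kiselman n) : M :=
  \prod_(i <- repr x) g i.

Definition kis_rels n (M : monoidType) (g : 'I_n -> M) : Prop :=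
  (forall i, g i * g i = g i) /\
  (forall i j : 'I_n, (j < i)%N ->
     g i * g j * g i = g i * g j /\ g j * g i * g j = g i * g j).

Lemma kgen_rels n : kis_rels (@kgen n).
Proof.
have mul2 i j : kgen i * kgen j = \pi_(kiselman n) [:: i; j].
  exact: (kis_mulgE [:: i] [:: j]).
have mul3 i j k : kgen i * kgen j * kgen k = \pi_(kiselman n) [:: i; j; k].
  by rewrite mul2; exact: (kis_mulgE [:: i; j] [:: k]).
split=> [i | i j ltji]; last split; rewrite ?mul3 mul2; apply/kis_piP.
- exact: kis_idem.
- exact: kis_aba.
- exact: kis_bab.
Qed.

Lemma kis_lift_pi n (M : monoidType) (g : 'I_n -> M) (u : seq 'I_n) :
  kis_rels g -> kis_lift g (\pi_(kiselman n) u) = \prod_(i <- u) g i.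
Proof.
move=> [gid grel].
have prodE v w : kis_cong v w -> \prod_(i <- v) g i = \prod_(i <- w) g i.
  elim=> {v w} [//|v w _ -> //|v w z _ -> //|v v' w w' _ Hv _ Hw|i|i j|i j].
  - by rewrite !big_cat Hv Hw.
  - by rewrite !big_cons !big_nil !mulg1.
  - by move=> /grel[H _]; rewrite !big_cons !big_nil !mulg1 mulgA.
  - by move=> /grel[_ H]; rewrite !big_cons !big_nil !mulg1 mulgA.
exact/prodE/kis_repr.
Qed.

Lemma kis_lift_morphism n (M : monoidType) (g : 'I_n -> M) :
  kis_rels g -> monoid_morphism (kis_lift g).
Proof.
move=> grel; split; first by rewrite (kis_lift_pi _ grel) big_nil.
move=> x y; elim/kis_ind: x => u; elim/kis_ind: y => v.
by rewrite kis_mulgE !(kis_lift_pi _ grel) big_cat.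
Qed.

Lemma kis_lift_gen n (M : monoidType) (g : 'I_n -> M) (i : 'I_n) :
  kis_rels g -> kis_lift g (kgen i) = g i.
Proof. by move=> grel; rewrite (kis_lift_pi _ grel) big_seq1. Qed.

Lemma kis_morphism_eq n (M : monoidType) (h h' : kiselman n -> M) :
  monoid_morphism h -> monoid_morphism h' ->
  (forall i, h (kgen i) = h' (kgen i)) -> h =1 h'.
Proof.
move=> [h1 hM] [h1' hM'] eqg x; elim/kis_ind: x => u; rewrite kis_pi_prod.
elim: u => [|i u IHu]; first by rewrite big_nil h1 h1'.
by rewrite big_cons hM hM' eqg IHu.
Qed.

(* enum lists X in increasing order, so the product is in decreasing order. *)
Definition kset n (X : {set 'I_n}) : kiselman n :=
  \prod_(i <- rev (enum X)) kgen i.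

Definition kzero n : kiselman n := kset [set: 'I_n].

Definition del_gen n (X : {set 'I_n}) (i : 'I_n) : kiselman n :=
  if i \in X then 1 else kgen i.

Lemma del_gen_rels n (X : {set 'I_n}) : kis_rels (del_gen X).
Proof.
have [gid grel] := kgen_rels n; rewrite /del_gen; split=> [i | i j ltji].
  by case: ifP => _; rewrite ?mulg1.
have [H1 H2] := grel i j ltji.
by do 2![case: ifP => _]; rewrite ?mulg1 ?mul1g ?gid.
Qed.

Definition kdel n (X : {set 'I_n}) : kiselman n -> kiselman n :=
  kis_lift (del_gen X).

Lemma kdel_morphism n (X : {set 'I_n}) : monoid_morphism (kdel X).
Proof. exact/kis_lift_morphism/del_gen_rels. Qed.

HB.instance Definition _ n (X : {set 'I_n}) :=
  isUMagmaMorphism.Build (kiselman n) (kiselman n) (kdel X) (kdel_morphism X).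

Lemma kdel_gen n (X : {set 'I_n}) (i : 'I_n) :
  kdel X (kgen i) = if i \in X then 1 else kgen i.
Proof. exact/kis_lift_gen/del_gen_rels. Qed.

(* The set [r] = {1, ..., r}, in the 0-based indexing. *)
Definition kseg (n r : nat) : {set 'I_n} := [set i : 'I_n | (i < r)%N].

Definition kdist n (x y : kiselman n) : nat :=
  [arg min_(i < (ord_max : 'I_n.+1) |
     kdel (kseg n i) x == kdel (kseg n i) y) (i : nat)].

Lemma kdel_segT n (x : kiselman n) : kdel (kseg n n) x = 1.
Proof.
elim/kis_ind: x => u; rewrite [LHS](kis_lift_pi _ (del_gen_rels _)) big1 // => i _.
by rewrite /del_gen inE ltn_ord.
Qed.

Lemma kdistP n (x y : kiselman n) :
  [/\ (kdist x y <= n)%N,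
      kdel (kseg n (kdist x y)) x = kdel (kseg n (kdist x y)) y
    & forall i, (i <= n)%N -> kdel (kseg n i) x = kdel (kseg n i) y ->
        (kdist x y <= i)%N].
Proof.
rewrite /kdist; case: arg_minnP => [|i /eqP eqi mini]; first by rewrite !kdel_segT.
split=> // [|j lejn eqj]; first by rewrite -ltnS.
by apply: (mini (Ordinal (lejn : (j < n.+1)%N))); apply/eqP.
Qed.

Definition kball n (a : kiselman n) (r : nat) : {pred kiselman n} :=
  [pred x | (kdist a x <= r)%N].

(* Main.v *)
Require Import Defs.
From mathcomp Require Import all_boot.

(** Right multiplication by [e_[r]] absorbs the generators of index at most [r]:
    if every letter of [u] exceeds [i], then [a_i u a_i = u a_i], and [e_[r]]
    supplies the second [a_i] preceded only by larger letters. Deleting letters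
    from right to left, [x e_[r]] equals the deletion of [[r]] in [x] times
    [e_[r]]. The other implication applies the deletion of [[r]] to
    [x e_[r] = f]. *)

Set Implicit Arguments.
Unset Strict Implicit.
Unset Printing Implicit Defensive.

Local Open Scope group_scope.

Lemma enum_ord_set_pairwise n (X : {set 'I_n}) :
  pairwise (fun i j : 'I_n => i < j)%N (enum X).
Proof.
rewrite /enum_mem; apply: (subseq_pairwise (filter_subseq _ _)).
rewrite -enumT -(pairwise_map val ltn) val_enum_ord.
by rewrite -(sorted_pairwise ltn_trans) iota_ltn_sorted.
Qed.

(** A strictly increasing list is determined by its members, so [enum X ++ enum Y] is
    [enum (X :|: Y)]; reversal swaps the factors. *)
Lemma kset_split n (X Y : {set 'I_n}) :
  {in X & Y, forall i j : 'I_n, (i < j)%N} ->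
  kset (X :|: Y) = kset Y * kset X.
Proof.
move=> ltXY; rewrite /kset -big_cat -rev_cat /=; congr (\prod_(i <- rev _) _).
have tr : transitive (fun i j : 'I_n => i < j)%N by move=> j i k; apply: ltn_trans.
apply: (irr_sorted_eq tr) => [i|||i]; first exact: ltnn.
- by rewrite (sorted_pairwise tr) enum_ord_set_pairwise.
- rewrite (sorted_pairwise tr) pairwise_cat !enum_ord_set_pairwise !andbT.
  by apply/allrelP => i j; rewrite !mem_enum; apply: ltXY.
- by rewrite mem_cat !mem_enum inE.
Qed.

Lemma kdel_prod n (X : {set 'I_n}) (u : seq 'I_n) :
  kdel X (\prod_(i <- u) kgen i) = \prod_(i <- u | i \notin X) kgen i.
Proof.
rewrite -kis_pi_prod [LHS](kis_lift_pi _ (del_gen_rels X)) [RHS]big_mkcond.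
by apply: eq_bigr => i _; rewrite /del_gen if_neg.
Qed.

Lemma kdel_kset n (X Y : {set 'I_n}) : kdel X (kset Y) = kset (Y :\: X).
Proof.
rewrite /kset kdel_prod -big_filter filter_rev; congr (\prod_(i <- rev _) _).
rewrite /enum_mem -filter_predI; apply: eq_filter => i /=.
by rewrite !inE.
Qed.

Lemma kgen_absorb n (i : 'I_n) (u : seq 'I_n) :
  all (fun j : 'I_n => i < j)%N u ->
  kgen i * \prod_(j <- u) kgen j * kgen i = \prod_(j <- u) kgen j * kgen i.
Proof.
have [gid grel] := kgen_rels n.
elim: u => [_|j u IHu /= /andP[ltij ltiu]]; first by rewrite big_nil mulg1 mul1g.
have [_ iji] := grel j i ltij.
(* The induction hypothesis, read backwards, inserts an [i] after [j]; then [i j i] collapses to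
   [j i], and the inserted [i] is absorbed again. *)
rewrite big_cons -!mulgA -(IHu ltiu) !mulgA iji.
by rewrite -!mulgA; congr (_ * _); rewrite !mulgA IHu.
Qed.

Lemma kgen_absorb_kset n (i : 'I_n) (X : {set 'I_n}) (u : seq 'I_n) :
  i \in X -> all (fun j : 'I_n => i < j)%N u ->
  kgen i * (\prod_(j <- u) kgen j * kset X) = \prod_(j <- u) kgen j * kset X.
Proof.
move=> iX ltiu; rewrite /kset.
have := enum_ord_set_pairwise X.
have /splitPr[s t] : i \in enum X by rewrite mem_enum.
rewrite pairwise_cat /= => /and3P[_ _ /andP[ltit _]].
(* The decreasing word of [X] is [rev t], [i], [rev s], with every letter of [t] above [i]:
   absorption applies to [u ++ rev t]. *)
rewrite rev_cat rev_cons cat_rcons big_cat big_cons /=.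
rewrite !mulgA -(mulgA (kgen i)) -!big_cat /= kgen_absorb //.
by rewrite all_cat ltiu all_rev.
Qed.

Lemma kdel_mul_kset n r (x : kiselman n) :
  kdel (kseg n r) x * kset (kseg n r) = x * kset (kseg n r).
Proof.
elim/kis_ind: x => u; rewrite kis_pi_prod kdel_prod.
elim: u => [|i u IHu]; first by rewrite !big_nil.
rewrite !big_cons -[in RHS]mulgA -IHu; case: ifPn => [_|]; first by rewrite mulgA.
(* The tail has already lost its letters in [kseg n r], so all that remain exceed [i]. *)
rewrite negbK => iX; rewrite -big_filter kgen_absorb_kset //.
apply/allP => j; rewrite mem_filter inE -leqNgt => /andP[lerj _].
by apply: leq_trans lerj; rewrite inE in iX.
Qed.

(** Deleting the larger segment factors through deleting the smaller one. Hence agreement at the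
    minimum [kdist] persists up to any radius above it. *)
Lemma kdel_seg_le n r s (x y : kiselman n) : (r <= s)%N ->
  kdel (kseg n r) x = kdel (kseg n r) y ->
  kdel (kseg n s) x = kdel (kseg n s) y.
Proof.
move=> lers eqr.
have kdelK z : kdel (kseg n s) (kdel (kseg n r) z) = kdel (kseg n s) z.
  elim/kis_ind: z => u; rewrite kis_pi_prod kdel_prod -big_filter !kdel_prod.
  rewrite big_filter_cond; apply: eq_bigl => i; rewrite !inE -!leqNgt.
  by apply: andb_idl; apply: leq_trans.
by rewrite -[LHS]kdelK eqr kdelK.
Qed.

Lemma kballP n r (a x : kiselman n) : (r <= n)%N ->
  x \in kball a r <-> kdel (kseg n r) a = kdel (kseg n r) x.
Proof.
move=> lern; have [_ eqd mind] := kdistP a x; rewrite inE.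
by split=> [led | ]; [apply: kdel_seg_le eqd | apply: mind].
Qed.

Theorem lemma7p2 (n r : nat) (x : kiselman n) (hn : (1 < n)%N) (hr : (r <= n)%N) :
  x \in kball (kzero n) r <-> (x * kset (kseg n r))%g = kzero n.
Proof.
have kdelf : kdel (kseg n r) (kzero n) = kset (~: kseg n r).
  by rewrite /kzero kdel_kset setTD.
have fE : kset (~: kseg n r) * kset (kseg n r) = kzero n.
  rewrite -kset_split ?setUCr // => i j; rewrite !inE -leqNgt.
  exact: leq_trans.
rewrite kballP //; split=> [eqx | xf].
  by rewrite -kdel_mul_kset -eqx kdelf fE.
(* The deletion sends the factor [kset (kseg n r)] to the unit, leaving only the deletion of [x]. *)
rewrite -xf (kdel_morphism _).2 kdel_kset setDv.
by rewrite [kset set0]/kset enum_set0 big_nil mulg1.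
Qed.
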